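(* For every constant $c>0$ there exists a constant $C>0$ such that the following holds. Let $G=(V,E)$ be a $d$-regular undirected graph on $n=|V|$ vertices, $2\le d<n$, which is a $\lambda$ spectral expander with $\lambda>0$ and $n\ge c\,d^3\log(d)/\lambda$. Then the graph code $(\mathrm{enc}_G,\mathrm{dec}_G)$ is an $\varepsilon$-non-malleable code in the split-state model with $\varepsilon\le C\,\frac{\lambda^{3/2}}{d}$. (In the paper's notation: if $n=\Omega(d^3\log(d)/\lambda)$ then the code is $O(\lambda^{3/2}/d)$-non-malleable.)
   Context: $E\subseteq V\times V$ is the symmetric set of ordered pairs of adjacent vertices. $G$ is a $\lambda$ spectral expander if, with $\lambda_1\ge\dots\ge\lambda_n$ the eigenvalues of its adjacency matrix, $\lambda\ge\max\{|\lambda_2|,\dots,|\lambda_n|\}$. The graph code: $\mathrm{enc}_G\colon\{0,1\}\to V\times V$ is randomized, with $\mathrm{enc}_G(0)$ uniform on $(V\times V)\setminus E$ and $\mathrm{enc}_G(1)$ uniform on $E$; $\mathrm{dec}_G(v_1,v_2)=1$ if $(v_1,v_2)\in E$ and $0$ otherwise. Split-state non-malleability: a coding scheme $\mathrm{enc}\colon\mathcal M\to\mathcal L\times\mathcal R$, $\mathrm{dec}\colon\mathcal L\times\mathcal R\to\mathcal M\cup\{\bot\}$ (here $\mathcal M=\{0,1\}$, $\mathcal L=\mathcal R=V$) with $\Pr[\mathrm{dec}(\mathrm{enc}(s))=s]=1$ is $\varepsilon$-non-malleable in the split-state model if for every pair of functions $g\colon\mathcal L\to\mathcal L$, $h\colon\mathcal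 R\to\mathcal R$ there is a distribution $D_{g,h}$ on $\mathcal M\cup\{*,\bot\}$ such that for every $s\in\mathcal M$ the random variable $\mathrm{dec}(g(L),h(R))$ with $(L,R)\leftarrow\mathrm{enc}(s)$ and the random variable obtained by sampling $\tilde s\leftarrow D_{g,h}$ and outputting $s$ if $\tilde s=*$ and $\tilde s$ otherwise, have statistical distance at most $\varepsilon$. *)

(* Defs.v *)
From HB Require Import structures.
From mathcomp Require Import all_boot all_order all_algebra.
From mathcomp Require Import reals exp.
Set Implicit Arguments. Unset Strict Implicit. Unset Printing Implicit Defensive.
Import Order.TTheory GRing.Theory Num.Theory.
Local Open Scope ring_scope.

Section GraphCode.
Variables (R : realType) (V : finType) (e : rel V).

Definition simple_graph := symmetric e /\ irreflexive e.

Definition regular (d : nat) := forall v : V, #|[set u | e v u]| = d.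

Definition adjmx : 'M[R]_#|V| :=
  \matrix_(i, j) (e (enum_val i) (enum_val j))%:R.

Definition spectral_expander (lam : R) :=
  exists s : seq R,
    [/\ size s = #|V|, sorted (>=%R) s,
        char_poly adjmx = \prod_(x <- s) ('X - x%:P)
      & forall i : nat, (0 < i < #|V|)%N -> `|nth 0 s i| <= lam].

Definition enc_prob (b : bool) (p : V * V) : R :=
  if e p.1 p.2 == b then (#|[set q : V * V | e q.1 q.2 == b]|%:R)^-1 else 0.

(* dec_G(v1,v2) = 1 iff (v1,v2) in E; outputs live in M u {bot},
   encoded as option bool (None = bot; never produced by dec_G) *)
Definition dec_G (p : V * V) : option bool := Some (e p.1 p.2).

Definition tampered (g h : V -> V) (s : bool) (o : option bool) : R :=
  \sum_(p : V * V) enc_prob s p * (dec_G (g p.1, h p.2) == o)%:R.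

End GraphCode.

(* simulator outcomes M u {*, bot}:
   Some (Some b) = message b, Some None = *, None = bot *)
Definition sim_out (s : bool) (t : option (option bool)) : option bool :=
  match t with
  | Some (Some b) => Some b
  | Some None => Some s
  | None => None
  end.

Definition is_distr (R : realType) (T : finType) (D : T -> R) :=
  (forall t, 0 <= D t) /\ \sum_t D t = 1.

Definition simulated (R : realType) (D : option (option bool) -> R)
    (s : bool) (o : option bool) : R :=
  \sum_t D t * (sim_out s t == o)%:R.

Definition stat_dist (R : realType) (T : finType) (P Q : T -> R) : R :=
  2^-1 * \sum_t `|P t - Q t|.

Definition graph_code_nm (R : realType) (V : finType) (e : rel V) (eps : R) :=
  forall g h : V -> V,
    exists D : option (option bool) -> R,
      is_distr D /\
      forall s : bool,
        stat_dist (tampered R e g h s) (simulated D s) <= eps.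

(* Main.v *)
Require Import Defs.
From HB Require Import structures.
From mathcomp Require Import all_boot all_order all_algebra.
From mathcomp Require Import reals exp.
From mathcomp Require Import complex ring lra.
Import Order.TTheory GRing.Theory Num.Theory.
Local Open Scope ring_scope.

(** For tamperings [g], [h] let [a x], [b y] be the sizes of their fibers and
    [M = A - d/n] the centered adjacency matrix. A bit can be simulated unless
    a non-edge is accepted more often than an edge, and that gap is
    [-1/(d(n-d))] times the sum over [u], [v] of [M u v * A (g u) (h v)].

    The sum is split with the threshold [k = d/lam]. Where [a, b < k], it is
    at least [-2 d^2], which the lower bound on [n] absorbs. Where
    [b <= a] and [k <= a], apply the mixing lemma, for each [x], to the fiber
    of [x] against the union of the fibers of its neighbours [y]; summing over
    [x] costs [lam * sqrt (n * B)], with [B] the sum of [b y] over these edges.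
    The point is that [B = O(lam n)]: since [b <= a], [B] is at most the sum of
    [min (a x) (b y) = \sum_t [t < a x] [t < b y]], and the mixing lemma at each
    level [t] loses nothing as the level sets of [a] and [b] have total size [n].
    The case [a < b] is symmetric. *)

Set Implicit Arguments.
Unset Strict Implicit.
Unset Printing Implicit Defensive.

(** * Bilinear forms of normal matrices off the top eigenvector *)

Section HermitianExpander.
Local Open Scope sesquilinear_scope.
Variables (C : numClosedFieldType) (n : nat).

Lemma diag_form (D z w : 'rV[C]_n) :
  (z *m diag_mx D *m w ^t*) 0 0 = \sum_i z 0 i * D 0 i * (w 0 i)^*.
Proof.
rewrite mul_mx_diag !mxE; apply: eq_bigr => i _; by rewrite !mxE.
Qed.

Lemma dotmx_sum (z w : 'rV[C]_n) :
  (z *m w ^t*) 0 0 = \sum_i z 0 i * (w 0 i)^*.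
Proof. by rewrite mxE; apply: eq_bigr => i _; rewrite !mxE. Qed.

Lemma dotmx_unitary (P : 'M[C]_n) (z w : 'rV[C]_n) : P \is unitarymx ->
  (z *m P ^t*) *m (w *m P ^t*) ^t* = z *m w ^t*.
Proof.
move=> Pu; rewrite trmx_mul map_mxM /= trmxCK mulmxA.
by rewrite -[X in X *m _ = _]mulmxA -invmx_unitary// mulVmx ?mulmx1// unitarymx_unit.
Qed.

Lemma char_poly_similar (P D : 'M[C]_n) : P \in unitmx ->
  char_poly (invmx P *m D *m P) = char_poly D.
Proof.
move=> Pu; pose f := map_mx (@polyC C).
have E1 : f _ _ (invmx P) *m f _ _ P = 1%:M.
  by rewrite /f -map_mxM mulVmx// map_mx1.
have -> : char_poly (invmx P *m D *m P) =
    \det (f _ _ (invmx P) *m char_poly_mx D *m f _ _ P).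
  rewrite /char_poly /char_poly_mx mulmxBr mulmxBl !map_mxM.
  by rewrite mul_mx_scalar -scalemxAl E1 scalemx1.
by rewrite !det_mulmx mulrAC -det_mulmx E1 det1 mul1r.
Qed.

(** Factorization into linear factors is unique, so the listed roots match the spectral diagonal
    with multiplicity. This is what later isolates a single coordinate for the top eigenvalue. *)
Lemma char_poly_diag_perm (A : 'M[C]_n) (s : seq C) : A \is normalmx ->
  char_poly A = \prod_(x <- s) ('X - x%:P) ->
  perm_eq s [seq spectral_diag A 0 i | i : 'I_n].
Proof.
move=> /orthomx_spectralP EA; rewrite {1}EA char_poly_similar ?spectral_unit//.
rewrite char_poly_trig ?diag_mx_is_trig// => hs.
apply: prod_XsubC_eq; rewrite -hs big_image /=; apply: eq_bigr => i _.
by rewrite mxE eqxx mulr1n.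
Qed.

(** Since [d] exceeds [lam] in modulus, it must be the root [s0], with multiplicity one. In a
    spectral basis [w] then has no component along [u], and AM-GM on each remaining coordinate gives
    the bound. *)
Lemma expander_form (A : 'M[C]_n) (s0 : C) (s : seq C) (d lam : C) (u : 'rV[C]_n) :
  A \is normalmx -> char_poly A = \prod_(x <- s0 :: s) ('X - x%:P) ->
  u != 0 -> u *m A = d *: u -> 0 <= lam -> ~~ (`|d| <= lam) ->
  (forall x, x \in s -> `|x| <= lam) ->
  forall z w : 'rV[C]_n, w *m u ^t* = 0 ->
  2%:R * `|(z *m A *m w ^t*) 0 0|
    <= lam * ((z *m z ^t*) 0 0 + (w *m w ^t*) 0 0).
Proof.
move=> An hs u0 uA lam0 dlam hlam z w wu.
have hperm := char_poly_diag_perm An hs.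
have Pu := spectral_unitarymx A.
have /orthomx_spectralP EA := An.
set P := spectralmx A in Pu EA; set D := spectral_diag A in EA hperm.
have {}EA : A = P ^t* *m diag_mx D *m P by rewrite -invmx_unitary.
have PP : P *m P ^t* = 1%:M by apply/unitarymxP.
set u' := u *m P ^t*; set z' := z *m P ^t*; set w' := w *m P ^t*.
(* In spectral coordinates [u'] is supported where [D] equals [d]. *)
have u'D i : u' 0 i * D 0 i = d * u' 0 i.
  have : u' *m diag_mx D = d *: u'.
    rewrite /u' scalemxAl -uA EA !mulmxA -[RHS]mulmxA PP mulmx1 //.
  by move=> /rowP/(_ i); rewrite mul_mx_diag !mxE.
have u'0 : u' != 0.
  apply: contraNneq u0 => u'0; apply/eqP.
  have : u' *m P = 0 by rewrite u'0 mul0mx.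
  by rewrite /u' -mulmxA -invmx_unitary// mulVmx ?unitarymx_unit// mulmx1.
have [i0 ui0] : exists i0, u' 0 i0 != 0 by apply/rV0Pn.
have Di0 : D 0 i0 = d by apply: (mulfI ui0); rewrite u'D mulrC.
(* One copy of [d] is split off the diagonal. As [d] is not in [s], it equals [s0], and [s] is left
   for the other coordinates. *)
have hperm2 : perm_eq (s0 :: s) (d :: [seq D 0 i | i in predC1 i0]).
  apply: (perm_trans hperm); rewrite -Di0.
  rewrite /image_mem -(map_cons (fun i => D 0 i)); apply: perm_map.
  apply: uniq_perm; rewrite ?enum_uniq//=.
    by rewrite enum_uniq mem_enum inE eqxx.
  by move=> i; rewrite inE !mem_enum !inE; case: eqP.
have ds : d \notin s by apply: contra dlam => /hlam.
have s0d : s0 = d.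
  have : d \in s0 :: s by rewrite (perm_mem hperm2) inE eqxx.
  by rewrite inE (negPf ds) orbF => /eqP.
have Dlam i : i != i0 -> `|D 0 i| <= lam.
  move=> ii0; apply: hlam; move: hperm2; rewrite s0d perm_cons => /perm_mem ->.
  by apply/imageP; exists i.
(* Outside [i0] the diagonal differs from [d], so [u'] vanishes there and orthogonality reduces to a
   single product. *)
have w'i0 : w' 0 i0 = 0.
  have : w' *m u' ^t* = 0 by rewrite dotmx_unitary.
  move=> /matrixP/(_ 0 0); rewrite dotmx_sum mxE (bigD1 i0)//= big1 ?addr0; last first.
    move=> i ii0; have /eqP := u'D i.
    rewrite mulrC -subr_eq0 -mulrBl mulf_eq0 subr_eq0 => /orP[/eqP Did|/eqP->].
      by move: (Dlam i ii0); rewrite Did (negPf dlam).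
    by rewrite rmorph0 mulr0.
  by move=> /eqP; rewrite mulf_eq0 conjC_eq0 (negPf ui0) orbF => /eqP.
have -> : z *m A *m w ^t* = z' *m diag_mx D *m w' ^t*.
  by rewrite EA /z' /w' trmx_mul map_mxM /= trmxCK !mulmxA.
rewrite -(dotmx_unitary z z Pu) -(dotmx_unitary w w Pu) -/z' -/w'.
rewrite diag_form !dotmx_sum -big_split /= !mulr_sumr.
apply: le_trans (_ : 2%:R * \sum_i `|z' 0 i * D 0 i * (w' 0 i)^*| <= _).
  by rewrite ler_wpM2l// ler_norm_sum.
rewrite mulr_sumr; apply: ler_sum => i _; rewrite -!normCK !normrM norm_conjC.
have [->|ii0] := eqVneq i i0.
  by rewrite w'i0 normr0 !mulr0 mulr_ge0// addr_ge0// exprn_ge0.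
rewrite mulrAC mulrA mulrC; apply: ler_pM => //.
- by rewrite mulr_ge0// mulr_ge0.
- exact: Dlam.
- rewrite mulrA -subr_ge0.
  rewrite [X in 0 <= X](_ : _ = (`|z' 0 i| - `|w' 0 i|) ^+ 2); last by ring.
  by rewrite real_exprn_even_ge0// realB.
Qed.

End HermitianExpander.

Lemma natr_card_set (R : realType) (T : finType) (P : pred T) :
  #|[set x | P x]|%:R = \sum_x (P x)%:R :> R.
Proof.
rewrite -sum1_card big_mkcond natr_sum; apply: eq_bigr => x _.
by rewrite inE; case: (P x).
Qed.

(** * The expander mixing lemma for real test functions *)

Section MixingLemma.
Local Open Scope sesquilinear_scope.
Variables (R : realType) (V : finType) (e : rel V) (d : nat) (lam : R).
Hypotheses (eS : simple_graph e) (eR : regular e d).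

Lemma sum_adj (u : V) : \sum_v (e u v)%:R = d%:R :> R.
Proof.
by rewrite -(eR u) natr_card_set.
Qed.

Lemma sum_adjr (v : V) : \sum_u (e u v)%:R = d%:R :> R.
Proof.
by rewrite -(sum_adj v); apply: eq_bigr => u _; rewrite eS.1.
Qed.

Hypotheses (V0 : (0 < #|V|)%N) (eL : spectral_expander e lam).
Hypotheses (lam0 : 0 <= lam) (lamd : lam < d%:R).

(** Centering [y] makes it orthogonal to the constants, the eigenvector for [d], and amounts to
    centering the adjacency matrix. A sum of squares in place of a product of norms lets the bound
    be rescaled and summed over families of test functions. *)
Lemma expander_mixing (x y : V -> R) :
  2%:R * `|\sum_u \sum_v ((e u v)%:R - d%:R / #|V|%:R) * (x u * y v)|
    <= lam * (\sum_u x u ^+ 2 + \sum_v y v ^+ 2).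
Proof.
case: eL => -[|s0 s] [hsz _ hchar hlam]; first by move: V0; rewrite -hsz.
(* The spectral theorem is applied over the complex numbers, so the real data are embedded by
   [f]. *)
pose f : {rmorphism R -> (complex R)} := real_complex R; pose m := (\sum_v y v) / #|V|%:R.
have nN0 : #|V|%:R != 0 :> R by rewrite pnatr_eq0 -lt0n.
have fconj (a : R) : (f a)^* = f a by apply/conj_Creal/complex_realP; exists a.
pose A : 'M[(complex R)]_#|V| := map_mx f (adjmx R e).
pose row (g : V -> R) : 'rV[(complex R)]_#|V| := \row_i f (g (enum_val i)).
have sum_enum (g : V -> R) : \sum_(i < #|V|) f (g (enum_val i)) = f (\sum_v g v).
  rewrite [in RHS](reindex_onto enum_val enum_rank) /=; last by move=> i _; rewrite enum_rankK.
  by rewrite rmorph_sum; apply: eq_bigl => i; rewrite enum_valK eqxx.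
have dot (g h : V -> R) : (row g *m (row h)^t*) 0 0 = f (\sum_v g v * h v).
  by rewrite dotmx_sum -sum_enum; apply: eq_bigr => i _; rewrite !mxE fconj rmorphM.
have An : A \is normalmx.
  apply/normalmxP; suff -> : A ^t* = A by [].
  by apply/matrixP => i j; rewrite !mxE fconj eS.1.
have Ac : char_poly A = \prod_(a <- f s0 :: [seq f a | a <- s]) ('X - a%:P).
  rewrite -map_char_poly hchar -(map_cons f) big_map rmorph_prod.
  by apply: eq_bigr => a _; rewrite /= rmorphB /= map_polyX map_polyC.
have rowA (g : V -> R) : row g *m A = row (fun v => \sum_u g u * (e u v)%:R).
  apply/rowP => j; rewrite !mxE -sum_enum; apply: eq_bigr => i _.
  by rewrite !mxE rmorphM.
have u0 : row (fun=> 1) != 0.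
  apply/rV0Pn; exists (Ordinal V0); by rewrite mxE rmorph1 oner_neq0.
have uA : row (fun=> 1) *m A = f d%:R *: row (fun=> 1).
  rewrite rowA; apply/rowP => j; rewrite !mxE rmorph1 mulr1 -(sum_adjr (enum_val j)).
  by congr (f _); apply: eq_bigr => v _; rewrite mul1r.
have sl a : a \in [seq f a | a <- s] -> `|a| <= f lam.
  move=> /mapP[b bs ->]; rewrite normc_def /= expr0n addr0 sqrtr_sqr lecR.
  move: bs => /(nthP 0)[i si <-]; apply: (hlam i.+1).
  by rewrite /= -hsz.
have dl : ~~ (`|f d%:R| <= f lam).
  by rewrite normc_def /= expr0n addr0 sqrtr_sqr lecR ger0_norm// -ltNge.
have l0 : 0 <= f lam by rewrite lecR.
have summ : \sum_v (y v - m) = 0.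
  by rewrite sumrB sumr_const -[m *+ _]mulr_natr /m divfK// subrr.
have yu : row (fun v => y v - m) *m (row (fun=> 1)) ^t* = 0.
  apply/matrixP => i j; rewrite !ord1 dot mxE.
  by under eq_bigr do rewrite mulr1; rewrite summ rmorph0.
have := expander_form An Ac u0 uA l0 dl sl (row x) yu.
rewrite rowA !dot normc_def /= expr0n addr0 sqrtr_sqr -(rmorph_nat f) -rmorphD -!rmorphM lecR => H.
apply: le_trans (le_trans H _).
  rewrite le_eqVlt; apply/orP; left; apply/eqP; congr (_ * `|_|).
  (* By the row sums [d], both forms equal the uncentered one minus [d * m * \sum_u x u]. *)
  rewrite exchange_big /=.
  under eq_bigr do under eq_bigr do rewrite mulrBl.
  under eq_bigr do rewrite sumrB.
  rewrite sumrB.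
  under [RHS]eq_bigr do rewrite mulrBr.
  rewrite sumrB; congr (_ - _).
    apply: eq_bigr => v _; rewrite mulr_suml; apply: eq_bigr => u _; ring.
  rewrite -mulr_suml [in RHS]exchange_big /=.
  under [in RHS]eq_bigr do rewrite -mulr_sumr sum_adj.
  rewrite -mulr_suml.
  under eq_bigr do rewrite -mulr_sumr -mulr_suml.
  by rewrite -!mulr_sumr /m; field.
rewrite ler_wpM2l//; under eq_bigr do rewrite -expr2; rewrite lerD2l.
under eq_bigr do rewrite -expr2.
(* Pythagoras: centering can only shrink the norm of [y]. *)
have -> : \sum_v (y v) ^+ 2 = \sum_v (y v - m) ^+ 2 + #|V|%:R * m ^+ 2.
  have E v : (y v) ^+ 2 = (y v - m) ^+ 2 + ((y v - m) * (2 * m) + m ^+ 2) by ring.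
  under eq_bigr do rewrite E.
  rewrite !big_split /= -mulr_suml summ mul0r add0r sumr_const; congr (_ + _).
  by rewrite mulr_natl.
by rewrite lerDl mulr_ge0// sqr_ge0.
Qed.
End MixingLemma.

(** * Fiber sizes and their level sets *)

Section Fibers.
Variables (R : realType) (V : finType).
Implicit Types g : V -> V.

Definition fiber g (x : V) : nat := #|[set u | g u == x]|.

Lemma fiberE g x : (fiber g x)%:R = \sum_u (g u == x)%:R :> R.
Proof. exact: natr_card_set. Qed.

Lemma sum_comp g (F : V -> R) : \sum_u F (g u) = \sum_x (fiber g x)%:R * F x.
Proof.
under [RHS]eq_bigr do rewrite fiberE mulr_suml.
rewrite exchange_big /=; apply: eq_bigr => u _.
rewrite (bigD1 (g u))//= eqxx mul1r big1 ?addr0// => x /negPf xg.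
by rewrite eq_sym xg mul0r.
Qed.

Lemma sum_fiber g : \sum_x (fiber g x)%:R = #|V|%:R :> R.
Proof.
under eq_bigr do rewrite -[_%:R]mulr1.
by rewrite -(sum_comp g (fun=> 1)) sumr_const.
Qed.

Lemma fiber_le g x : (fiber g x <= #|V|)%N.
Proof. exact: max_card. Qed.

(** A cut-off [N] common to all fibers lets one sum over levels serve every vertex. *)
Lemma layer_cake (m N : nat) : (m <= N)%N -> \sum_(t < N) (t < m)%:R = m%:R :> R.
Proof.
move=> mN; have -> : m%:R = \sum_(t < m) 1 :> R by rewrite sumr_const card_ord.
rewrite (big_ord_widen N (fun=> 1) mN) [RHS]big_mkcond.
by apply: eq_bigr => t _; case: (t < m)%N.
Qed.

End Fibers.

(** * Lower bound on the centered count of edges sent to edges *)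

Section Deficit.
Variables (R : realType) (V : finType) (e : rel V) (d : nat) (lam mu k : R).
Let n : R := #|V|%:R.
Let A x y : R := (e x y)%:R.
Let c : R := d%:R / n.
Hypotheses (eS : simple_graph e) (eR : regular e d).
Hypotheses (V0 : (0 < #|V|)%N) (mu0 : 0 < mu) (lamE : lam = mu ^+ 2).
Hypotheses (k0 : 0 < k) (lamk : lam * k = d%:R).
Hypothesis mix : forall x y : V -> R,
  2%:R * `|\sum_u \sum_v (A u v - c) * (x u * y v)|
    <= lam * (\sum_u x u ^+ 2 + \sum_v y v ^+ 2).

Let n0 : 0 < n. Proof. by rewrite ltr0n. Qed.
Let lam0 : 0 < lam. Proof. by rewrite lamE exprn_gt0. Qed.
Let c0 : 0 <= c. Proof. by rewrite divr_ge0. Qed.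

Lemma mixing_le (x y : V -> R) :
  2%:R * (\sum_u \sum_v (A u v - c) * (x u * y v))
    <= lam * (\sum_u x u ^+ 2 + \sum_v y v ^+ 2).
Proof. by apply: le_trans (mix x y); rewrite ler_wpM2l// ler_norm. Qed.

Lemma sum_adj_split (x y : V -> R) :
  \sum_u \sum_v A u v * (x u * y v) =
  \sum_u \sum_v (A u v - c) * (x u * y v) + c * ((\sum_u x u) * (\sum_v y v)).
Proof.
rewrite big_distrl mulr_sumr -big_split; apply: eq_bigr => u _ /=.
rewrite !mulr_sumr -big_split; apply: eq_bigr => v _ /=; ring.
Qed.

Lemma sqr_bool (b : bool) : (b%:R : R) ^+ 2 = b%:R.
Proof. by case: b; rewrite ?expr1n ?expr0n. Qed.

Lemma ler_bool (b1 b2 : bool) : (b1 -> b2) -> b1%:R <= b2%:R :> R.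
Proof. by case: b1 => [->|]//; rewrite ler0n. Qed.

(** The minimum counts the levels below both fiber sizes, so the sum becomes one of edge counts
    between level sets [X t] and [Y t]. The mixing errors add up to at most [lam * n] because the
    level sets on each side have total size at most [n]; the expected counts do so because at most
    [n / k] vertices are heavy. *)
Lemma heavy_edges (g h : V -> V) :
  \sum_x \sum_y A x y * (k <= (fiber g x)%:R)%R%:R * (minn (fiber g x) (fiber h y))%:R
    <= 2%:R * lam * n.
Proof.
pose a := fiber g; pose b := fiber h.
pose X (t : 'I_#|V|) x : R := ((k <= (a x)%:R)%R && (t < a x)%N)%:R.
pose Y (t : 'I_#|V|) y : R := (t < b y)%N%:R.
have minE x y : (k <= (a x)%:R)%R%:R * (minn (a x) (b y))%:R
    = \sum_t X t x * Y t y.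
  rewrite -(@layer_cake R (minn (a x) (b y)) #|V|); last by rewrite geq_min fiber_le.
  rewrite mulr_sumr; apply: eq_bigr => t _.
  by rewrite /X /Y leq_min -!mulnb !natrM mulrA.
have -> : \sum_x \sum_y A x y * (k <= (a x)%:R)%R%:R * (minn (a x) (b y))%:R
    = \sum_t \sum_x \sum_y A x y * (X t x * Y t y).
  rewrite [RHS]exchange_big; apply: eq_bigr => x _ /=.
  rewrite [RHS]exchange_big; apply: eq_bigr => y _ /=.
  by rewrite -mulrA minE mulr_sumr.
under eq_bigr do rewrite sum_adj_split.
rewrite big_split /= (_ : 2%:R * lam * n = lam * n + lam * n); last by ring.
apply: lerD.
  rewrite -(ler_pM2l (_ : 0 < 2%:R :> R))// mulr_sumr.
  apply: le_trans (ler_sum _ (fun t _ => mixing_le (X t) (Y t))) _.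
  rewrite -mulr_sumr big_split /= [leRHS](_ : _ = lam * (n + n)); last by ring.
  rewrite ler_pM2l//; apply: lerD.
    rewrite exchange_big /n -(sum_fiber R g); apply: ler_sum => x _ /=.
    rewrite -(@layer_cake R (a x) #|V|) ?fiber_le//; apply: ler_sum => t _.
    by rewrite sqr_bool ler_bool// => /andP[].
  rewrite exchange_big /n -(sum_fiber R h); apply: ler_sum => x _ /=.
  rewrite -(@layer_cake R (b x) #|V|) ?fiber_le//; apply: ler_sum => t _.
  by rewrite sqr_bool.
rewrite -mulr_sumr.
(* Summing the expected counts over [t] restores the minimum, which is at most [b y]; these sizes
   total [n]. *)
apply: le_trans (_ : c * ((\sum_x (k <= (a x)%:R)%R%:R) * n) <= _).
  rewrite ler_wpM2l// /n -(sum_fiber R h).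
  under eq_bigr do rewrite mulr_suml.
  rewrite exchange_big mulr_suml; apply: ler_sum => x _ /=.
  under eq_bigr do rewrite mulr_sumr.
  rewrite exchange_big mulr_sumr; apply: ler_sum => y _ /=.
  by rewrite -minE ler_wpM2l// ler_nat geq_minr.
(* Here [c * n = d = lam * k], and [k] times the number of heavy vertices is at most the total fiber
   size [n]. *)
rewrite [leLHS](_ : _ = lam * (k * \sum_x (k <= (a x)%:R)%R%:R)); last first.
  by rewrite [RHS]mulrA lamk /c; field; rewrite gt_eqF.
rewrite ler_pM2l// /n -(sum_fiber R g) mulr_sumr; apply: ler_sum => x _.
by case: (boolP (k <= _)) => H; rewrite ?mulr1 ?mulr0.
Qed.

(* Scaling the fiber indicators by [mu = sqrt lam] balances the two squared norms in the
   mixing lemma. *)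
Lemma heavy_deficit (g h : V -> V) (P : rel V) :
  (forall x y, P x y -> (fiber h y <= fiber g x)%N /\ k <= (fiber g x)%:R) ->
  - (2%:R * \sum_u \sum_v (A u v - c) * (A (g u) (h v) * (P (g u) (h v))%:R))
    <= 3%:R * mu ^+ 3 * n.
Proof.
(* [W x] marks the [v] sent by [h] to a neighbour of [x] allowed by [P]. Grouping the [u] by
   [x = g u] leaves one mixing estimate per [x]. *)
move=> hP; pose W x v : R := (e x (h v) && P x (h v))%:R.
have WE : \sum_u \sum_v (A u v - c) * (A (g u) (h v) * (P (g u) (h v))%:R)
   = \sum_x \sum_u \sum_v (A u v - c) * ((g u == x)%:R * W x v).
  rewrite [RHS]exchange_big; apply: eq_bigr => u _ /=.
  rewrite [RHS]exchange_big; apply: eq_bigr => v _ /=.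
  rewrite [RHS](bigD1 (g u))//= [X in _ = _ + X]big1 ?addr0 => [|x /negPf xg].
    by rewrite eqxx mul1r /W -mulnb natrM.
  by rewrite eq_sym xg mul0r mulr0.
rewrite WE -(ler_pM2l mu0).
have mixx x : mu * - (2%:R * \sum_u \sum_v (A u v - c) * ((g u == x)%:R * W x v))
    <= lam * (mu ^+ 2 * (fiber g x)%:R + \sum_v W x v).
  (* The minus sign turns the one-sided estimate into a lower bound on the form. *)
  have := mixing_le (fun u => - mu * (g u == x)%:R) (W x).
  have -> : \sum_u (- mu * (g u == x)%:R) ^+ 2 = mu ^+ 2 * (fiber g x)%:R.
    by rewrite fiberE mulr_sumr; apply: eq_bigr => u _; rewrite exprMn sqrrN sqr_bool.
  have -> : \sum_v W x v ^+ 2 = \sum_v W x v by apply: eq_bigr => v _; rewrite sqr_bool.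
  apply: le_trans; rewrite le_eqVlt; apply/orP; left; apply/eqP.
  rewrite mulrN mulrCA -mulrN -mulNr; congr (_ * _); rewrite mulr_sumr.
  by apply: eq_bigr => u _; rewrite mulr_sumr; apply: eq_bigr => v _; ring.
have -> : mu * - (2%:R * \sum_x \sum_u \sum_v (A u v - c) * ((g u == x)%:R * W x v))
   = \sum_x mu * - (2%:R * \sum_u \sum_v (A u v - c) * ((g u == x)%:R * W x v)).
  by rewrite -mulr_sumr sumrN mulr_sumr.
apply: le_trans (ler_sum _ (fun x _ => mixx x)) _.
rewrite -mulr_sumr big_split /= -mulr_sumr sum_fiber.
rewrite [leRHS](_ : _ = lam * (mu ^+ 2 * n + 2%:R * lam * n)); last by rewrite lamE; ring.
(* The total weight of the [W x] is the sum of the fiber sizes of [h] at [y] over the edges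
   satisfying [P]. There [x] is heavy and this size is the minimum, so [heavy_edges] applies. *)
rewrite ler_pM2l// lerD2l; apply: le_trans (heavy_edges g h).
apply: ler_sum => x _.
rewrite (sum_comp h (fun y => (e x y && P x y)%:R)); apply: ler_sum => y _.
rewrite -mulnb natrM mulrCA -mulrA ler_wpM2l//.
case: (boolP (P x y)) => [/hP[/minn_idPr -> ->]|_]; first by rewrite mul1r mulr1.
by rewrite mulr0 mulr_ge0.
Qed.

(** As [A u v] is nonnegative, each pair costs at most [c = d / n]. At most [2 * d * n] pairs land
    on light edges: [d * n] from the mixing error, since the truncated fibers have squared norm at
    most [k * n] and [lam * k = d], and [d * n] from the expected count. *)
Lemma light_deficit (g h : V -> V) (P : rel V) :
  (forall x y, P x y -> (fiber g x)%:R <= k /\ (fiber h y)%:R <= k) ->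
  - (\sum_u \sum_v (A u v - c) * (A (g u) (h v) * (P (g u) (h v))%:R))
    <= 2%:R * d%:R ^+ 2.
Proof.
move=> hP.
pose tr (f : V -> V) x : R := ((fiber f x)%:R <= k)%R%:R * (fiber f x)%:R.
apply: le_trans (_ : c * \sum_x \sum_y A x y * (tr g x * tr h y) <= _).
  apply: le_trans (_ : c * \sum_u \sum_v A (g u) (h v) * (P (g u) (h v))%:R <= _).
    rewrite -sumrN mulr_sumr; apply: ler_sum => u _.
    rewrite -sumrN mulr_sumr; apply: ler_sum => v _.
    rewrite -mulNr ler_wpM2r ?mulr_ge0// opprB gerBl; exact: ler0n.
  rewrite ler_wpM2l//.
  rewrite (sum_comp g (fun x => \sum_v A x (h v) * (P x (h v))%:R)).
  apply: ler_sum => x _.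
  rewrite (sum_comp h (fun y => A x y * (P x y)%:R)) mulr_sumr.
  apply: ler_sum => y _; rewrite /tr.
  case: (boolP (P x y)) => [/hP[-> ->]|_]; last first.
    by rewrite !mulr0 mulr_ge0 ?mulr_ge0 ?mulr_ge0 // ler0n.
  by rewrite !mul1r mulr1 le_eqVlt; apply/orP; left; apply/eqP; ring.
have tr0 f x : 0 <= tr f x by rewrite mulr_ge0.
have trle f x : tr f x <= (fiber f x)%:R.
  by rewrite /tr; case: (_ <= k); rewrite ?mul1r// mul0r.
have trn f : \sum_x tr f x <= n.
  by rewrite /n -(sum_fiber R f); apply: ler_sum.
have trsq f : \sum_x tr f x ^+ 2 <= k * n.
  rewrite /n -(sum_fiber R f) mulr_sumr; apply: ler_sum => x _.
  rewrite expr2 ler_pM// /tr; case: (boolP ((fiber f x)%:R <= k)) => // H.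
    by rewrite mul1r.
  by rewrite mul0r ltW.
rewrite sum_adj_split.
have H1 := mixing_le (tr g) (tr h).
have H2 : lam * (\sum_u tr g u ^+ 2 + \sum_v tr h v ^+ 2) <= lam * (k * n + k * n).
  by rewrite ler_pM2l// lerD.
have H3 : c * ((\sum_u tr g u) * (\sum_v tr h v)) <= d%:R * n.
  rewrite [leRHS](_ : _ = c * (n * n)); last by rewrite /c; field; rewrite gt_eqF.
  by rewrite ler_wpM2l// ler_pM// sumr_ge0.
rewrite [leRHS](_ : _ = c * (2%:R * d%:R * n)); last by rewrite /c; field; rewrite gt_eqF.
rewrite ler_wpM2l//.
have E : lam * (k * n + k * n) = 2%:R * d%:R * n by rewrite -lamk; ring.
rewrite E in H2; lra.
Qed.

Lemma deficit_le (g h : V -> V) :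
  - (\sum_u \sum_v (A u v - c) * A (g u) (h v)) <= 3%:R * mu ^+ 3 * n + 2%:R * d%:R ^+ 2.
Proof.
pose a x : R := (fiber g x)%:R; pose b y : R := (fiber h y)%:R.
(* A pair is charged to its larger fiber if that reaches [k], with ties going to [P1]. Otherwise
   both fibers are below [k], which is [P3]. *)
pose P1 x y := (b y <= a x) && (k <= a x).
pose P2 x y := (a x < b y) && (k <= b y).
pose P3 x y := ~~ P1 x y && ~~ P2 x y.
have PE x y : (P1 x y)%:R + (P2 x y)%:R + (P3 x y)%:R = 1 :> R.
  rewrite /P3 /P1 /P2; case: (ltrP (a x) (b y)) => _ /=; case: (k <= _);
  by rewrite /= ?addr0 ?add0r.
have H1 : - (2%:R * \sum_u \sum_v (A u v - c) * (A (g u) (h v) * (P1 (g u) (h v))%:R))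
    <= 3%:R * mu ^+ 3 * n.
  by apply: heavy_deficit => x y /andP[]; rewrite /a /b ler_nat.
have H2 : - (2%:R * \sum_u \sum_v (A u v - c) * (A (g u) (h v) * (P2 (g u) (h v))%:R))
    <= 3%:R * mu ^+ 3 * n.
  (* Symmetry of [e] exchanges the roles of [g] and [h]. *)
  rewrite exchange_big /=.
  have -> : \sum_v \sum_u (A u v - c) * (A (g u) (h v) * (P2 (g u) (h v))%:R)
     = \sum_v \sum_u (A v u - c) * (A (h v) (g u) * (P2 (g u) (h v))%:R).
    by apply: eq_bigr => v _; apply: eq_bigr => u _; rewrite /A eS.1 [e (g u) _]eS.1.
  apply: (heavy_deficit (P := fun y x => P2 x y)) => x y /andP[].
  by rewrite /a /b ltr_nat => /ltnW.
have H3 : - (\sum_u \sum_v (A u v - c) * (A (g u) (h v) * (P3 (g u) (h v))%:R))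
    <= 2%:R * d%:R ^+ 2.
  apply: light_deficit => x y; rewrite /P3 /P1 /P2 -/(a x) -/(b y).
  by case: (ltrP (a x) (b y)) => /= ab; rewrite ?andbT -ltNge => H; split; lra.
have -> : \sum_u \sum_v (A u v - c) * A (g u) (h v) =
  \sum_u \sum_v (A u v - c) * (A (g u) (h v) * (P1 (g u) (h v))%:R) +
  \sum_u \sum_v (A u v - c) * (A (g u) (h v) * (P2 (g u) (h v))%:R) +
  \sum_u \sum_v (A u v - c) * (A (g u) (h v) * (P3 (g u) (h v))%:R).
  rewrite -!big_split; apply: eq_bigr => u _ /=.
  rewrite -!big_split; apply: eq_bigr => v _ /=.
  by rewrite -!mulrDr PE mulr1.
lra.
Qed.

(* The mixing lemma for a vertex against its neighbourhood. *)
Lemma lam_ge_half : (0 < d)%N -> 2%:R * d%:R <= n -> 2^-1 <= lam.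
Proof.
move=> dp dn; have /card_gt0P[u0 _] := V0.
have := mixing_le (fun u => (u == u0)%:R) (fun v => A u0 v).
rewrite (bigD1 u0)//= eqxx [X in _ * (_ + X)]big1 => [|u /negPf ->]; last first.
  by apply: big1 => v _; rewrite mul0r mulr0.
have -> : \sum_v (A u0 v - c) * (1 * A u0 v) = d%:R * (1 - c).
  rewrite -(sum_adj R eR u0) mulr_suml; apply: eq_bigr => v _.
  by rewrite mul1r mulrC mulrBr mulrBr mulr1 -expr2 sqr_bool.
have -> : \sum_u ((u == u0)%:R : R) ^+ 2 = 1.
  by rewrite (bigD1 u0)//= eqxx expr1n big1 ?addr0// => u /negPf ->; rewrite expr0n.
have -> : \sum_v (A u0 v) ^+ 2 = d%:R.
  by rewrite -(sum_adj R eR u0); apply: eq_bigr => v _; rewrite sqr_bool.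
(* With [c <= 1/2] and [d >= 1], the bound [2 * d * (1 - c) <= lam * (1 + d)] yields
   [d <= 2 * d * lam]. *)
have c2 : 2%:R * c <= 1 by rewrite /c mulrA ler_pdivrMr// mul1r.
have d1 : 1 <= d%:R :> R by rewrite ler1n.
rewrite addr0; nra.
Qed.

End Deficit.

(** * From non-malleability to a gap of acceptance probabilities *)

Section NonMalleability.
Variables (R : realType) (V : finType) (e : rel V) (d : nat).
Let n : R := #|V|%:R.
Hypotheses (eS : simple_graph e) (eR : regular e d).
Hypotheses (d0 : (0 < d)%N) (dn : (d < #|V|)%N).

Let d0' : 0 < d%:R :> R. Proof. by rewrite ltr0n. Qed.
Let dn' : d%:R < n :> R. Proof. by rewrite ltr_nat. Qed.

Lemma sum_option (T : finType) (F : option T -> R) :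
  \sum_o F o = F None + \sum_t F (Some t).
Proof.
rewrite (bigD1 None)//=; congr (_ + _).
rewrite (reindex_omap Some id) => [|[]//].
by apply: eq_bigl => t; rewrite /= eqxx.
Qed.

Lemma card_edges b :
  #|[set q : V * V | e q.1 q.2 == b]|%:R
    = (if b then d%:R * n else n * (n - d%:R)) :> R.
Proof.
rewrite natr_card_set -(pair_bigA _ (fun u v => (e u v == b)%:R)) /=.
case: b.
  under eq_bigr do (under eq_bigr do rewrite eqb_id; rewrite (sum_adj R eR)).
  by rewrite sumr_const mulr_natr.
have E u v : (e u v == false)%:R = 1 - (e u v)%:R :> R.
  by case: (e u v); rewrite /= ?subrr ?subr0.
under eq_bigr do (under eq_bigr do rewrite E; rewrite sumrB (sum_adj R eR) sumr_const).
by rewrite sumr_const mulr_natl.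
Qed.

Lemma card_edges_gt0 b : 0 < #|[set q : V * V | e q.1 q.2 == b]|%:R :> R.
Proof.
have n0 : 0 < n := lt_trans d0' dn'.
by rewrite card_edges; case: b; rewrite mulr_gt0// subr_gt0.
Qed.

Lemma enc_probE b (p : V * V) : enc_prob R e b p
  = (e p.1 p.2 == b)%:R / #|[set q : V * V | e q.1 q.2 == b]|%:R.
Proof. by rewrite /enc_prob; case: ifP => _; rewrite ?mul1r ?mul0r. Qed.

Lemma sum_enc_prob b : \sum_p enc_prob R e b p = 1.
Proof.
under eq_bigr do rewrite enc_probE.
by rewrite -mulr_suml -natr_card_set divff// gt_eqF// card_edges_gt0.
Qed.

(** Decoding never yields bot, so this one number determines the whole tampered distribution. *)
Definition accept (g h : V -> V) (b : bool) : R := tampered R e g h b (Some true).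

Lemma accept_ge0 g h b : 0 <= accept g h b.
Proof.
apply: sumr_ge0 => p _; rewrite mulr_ge0// enc_probE mulr_ge0// invr_ge0; exact: ler0n.
Qed.

Lemma tampered_None g h b : tampered R e g h b None = 0.
Proof. by apply: big1 => p _; rewrite mulr0. Qed.

Lemma tampered_false g h b : tampered R e g h b (Some false) = 1 - accept g h b.
Proof.
rewrite -(sum_enc_prob b) /accept /tampered -sumrB; apply: eq_bigr => p _.
by rewrite /dec_G; case: (e _ _); rewrite /= ?mulr0 ?mulr1 ?subrr ?subr0.
Qed.

Lemma accept_le1 g h b : accept g h b <= 1.
Proof.
rewrite -subr_ge0 -tampered_false; apply: sumr_ge0 => p _.
rewrite mulr_ge0// enc_probE mulr_ge0// invr_ge0; exact: ler0n.
Qed.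

(** A one-sided gap suffices: if edges are accepted more often than non-edges, the excess is
    simulated exactly by the outcome that returns the message itself. *)
Lemma nm_of_accept_gap (eps : R) : 0 <= eps ->
  (forall g h, accept g h false - accept g h true <= eps) ->
  graph_code_nm e eps.
Proof.
move=> eps0 gap g h.
have := gap g h; have := accept_ge0 g h true; have := accept_ge0 g h false.
have := accept_le1 g h true; have := accept_le1 g h false.
set P0 := accept g h false; set P1 := accept g h true => P0le P1le P0ge P1ge gapgh.
pose a := Num.max (P1 - P0) 0.
have [a0 aP aP' aE] : [/\ 0 <= a, P0 + a <= 1, P1 <= P0 + a & P0 + a - P1 <= eps].
  by rewrite /a; case: (lerP (P1 - P0) 0) => H; split; lra.
(* With [a = max (P1 - P0) 0], message 0 is simulated exactly, while message 1 is accepted with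
   probability [max P0 P1] instead of [P1]. *)
exists (fun t => match t with
  | Some (Some true) => P0 | Some (Some false) => 1 - P0 - a
  | Some None => a | None => 0 end); split.
  split; first by case=> [[[]|]|]; lra.
  rewrite !sum_option big_bool /=; lra.
move=> s; rewrite /stat_dist sum_option big_bool /simulated !sum_option !big_bool /=.
rewrite tampered_None tampered_false -/(accept g h s).
case: s => /=; rewrite -?/P0 -?/P1 ?(mulr0, mulr1, add0r, addr0, subr0, oppr0, subrr, normr0).
  rewrite (_ : P1 - _ = - (P0 + a - P1)); last by ring.
  rewrite (_ : 1 - P1 - _ = P0 + a - P1); last by ring.
  rewrite normrN ger0_norm; last by lra.
  lra.
rewrite (_ : 1 - P0 - _ = 0); last by ring.
by rewrite normr0; lra.
Qed.

Lemma accept_gap g h : accept g h false - accept g h true =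
  - (\sum_u \sum_v ((e u v)%:R - d%:R / n) * (e (g u) (h v))%:R) / (d%:R * (n - d%:R)).
Proof.
have acE b : accept g h b = (\sum_u \sum_v (e u v == b)%:R * (e (g u) (h v))%:R)
    / #|[set q : V * V | e q.1 q.2 == b]|%:R.
  rewrite pair_bigA mulr_suml; apply: eq_bigr => p _.
  by rewrite enc_probE mulrAC /dec_G /=; case: (e (g p.1) (h p.2)).
rewrite !acE !card_edges.
(* [S] counts the edges sent to edges and [T] all pairs sent to edges, so [T - S] counts the
   non-edges sent to edges. *)
pose S : R := \sum_u \sum_v (e u v)%:R * (e (g u) (h v))%:R.
pose T : R := \sum_u \sum_v (e (g u) (h v))%:R.
have -> : \sum_u \sum_v (e u v == true)%:R * (e (g u) (h v))%:R = S.
  by apply: eq_bigr => u _; apply: eq_bigr => v _; rewrite eqb_id.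
have -> : \sum_u \sum_v (e u v == false)%:R * (e (g u) (h v))%:R = T - S.
  rewrite -sumrB; apply: eq_bigr => u _; rewrite -sumrB; apply: eq_bigr => v _.
  by case: (e u v); rewrite /= ?mul1r ?mul0r ?subrr ?subr0.
have -> : \sum_u \sum_v ((e u v)%:R - d%:R / n) * (e (g u) (h v))%:R = S - d%:R / n * T.
  rewrite mulr_sumr -sumrB; apply: eq_bigr => u _.
  rewrite mulr_sumr -sumrB; apply: eq_bigr => v _; ring.
field; rewrite !gt_eqF ?subr_gt0//; exact: lt_trans dn'.
Qed.

End NonMalleability.

(** * Choice of the constant and the extreme ranges of the parameters *)

Unset Implicit Arguments.

Theorem theoremB1 (R : realType) (c : R) (hc : 0 < c) :
  exists C : R, 0 < C /\
    forall (V : finType) (e : rel V) (d : nat) (lam : R),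
      simple_graph e -> regular e d ->
      (2 <= d)%N -> (d < #|V|)%N ->
      spectral_expander e lam -> 0 < lam ->
      c * (d%:R ^+ 3) * ln (d%:R : R) / lam <= #|V|%:R ->
      graph_code_nm e (C * powR lam (3%:R / 2%:R) / d%:R).
Proof.
(* As [d >= 2] gives [ln d >= ln 2], the lower bound on [n] yields [K * d ^ 3 <= lam * n]. *)
pose K : R := c * ln 2.
have K0 : 0 < K by rewrite mulr_gt0// ln_gt0// ltr1n.
(* The first two terms serve the main case; [2 / K] and [1 / K ^ 2] serve [n < 2 * d] with [mu >= 1]
   and [mu < 1] respectively. *)
exists (6%:R + 4%:R / K + 2%:R / K + (K ^+ 2)^-1); split.
  by rewrite !addr_gt0// ?divr_gt0// invr_gt0 exprn_gt0.
move=> V e d lam eS eR d2 dn eL lam0 hn.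
set Cc := (X in X * powR _ _).
pose n : R := #|V|%:R; pose mu := Num.sqrt lam.
have mu0 : 0 < mu by rewrite sqrtr_gt0.
have lamE : lam = mu ^+ 2 by rewrite sqr_sqrtr// ltW.
have d0 : (0 < d)%N by apply: leq_trans d2.
have d2' : 2 <= d%:R :> R by rewrite ler_nat.
have d0' : 0 < d%:R :> R by rewrite ltr0n.
have dn' : d%:R < n by rewrite ltr_nat.
have V0 : (0 < #|V|)%N by apply: leq_trans dn.
have -> : powR lam (3%:R / 2%:R) = mu ^+ 3.
  have -> : 3%:R / 2%:R = 1 + 2^-1 :> R by field.
  rewrite powRD ?powRr1 ?ltW//; last by rewrite (gt_eqF lam0) implybT.
  by rewrite powR12_sqrt ?ltW// -/mu {1}lamE -exprSr.
have nK : K * d%:R ^+ 3 <= lam * n.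
  move: hn; rewrite ler_pdivrMr// [_ * lam]mulrC; apply: le_trans.
  rewrite [leRHS]mulrAC ler_pM2r ?exprn_gt0// ler_pM2l//.
  by rewrite ler_ln// posrE.
clearbody K.
have gap1 g h : accept R e g h false - accept R e g h true <= 1.
  by have := accept_le1 R eR d0 dn g h false; have := accept_ge0 R e g h true; lra.
have eps0 : 0 <= Cc * mu ^+ 3 / d%:R.
  by rewrite divr_ge0// mulr_ge0 ?exprn_ge0 ?ltW// !addr_gt0// ?divr_gt0// invr_gt0 exprn_gt0.
apply: (nm_of_accept_gap eR d0 dn eps0) => g h.
have C1 : 6%:R <= Cc /\ 6%:R + 4%:R / K <= Cc /\ 2%:R / K <= Cc /\ (K ^+ 2)^-1 <= Cc.
  have h1 : 0 < K^-1 by rewrite invr_gt0.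
  have h2 : 0 < (K ^+ 2)^-1 by rewrite invr_gt0 exprn_gt0.
  rewrite /Cc; lra.
(* If [lam >= d], the claimed error is at least 1 and the trivial gap bound is enough. *)
have [lamd|dlam] := ltrP lam d%:R; last first.
  apply: le_trans (gap1 g h) _; rewrite ler_pdivlMr// mul1r.
  have mu1 : 1 <= mu by rewrite lamE in dlam; nra.
  apply: le_trans dlam _; rewrite (_ : mu ^+ 3 = mu * lam); last by rewrite lamE exprS.
  by rewrite mulrA ler_peMl ?ltW//; nra.
(* If [n < 2 * d], then [K * d ^ 2 <= 2 * lam], and the claimed error is again at least 1. *)
have [n2|n2] := lerP (2%:R * d%:R) n; last first.
  apply: le_trans (gap1 g h) _; rewrite ler_pdivlMr// mul1r.
  have Kd2 : K * d%:R ^+ 2 <= 2%:R * lam.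
    rewrite -(ler_pM2r d0') -mulrA -exprSr; apply: le_trans nK _.
    by rewrite [leRHS](_ : _ = lam * (2%:R * d%:R)); [rewrite ler_pM2l// ltW | ring].
  have [mu1|mu1] := lerP 1 mu.
    have dK : d%:R <= 2%:R / K.
      rewrite ler_pdivlMr// mulrC -(ler_pM2r d0') -mulrA -expr2.
      by apply: le_trans Kd2 _; rewrite ler_pM2l// ltW.
    have mu3 : 1 <= mu ^+ 3 by rewrite exprn_ege1.
    apply: le_trans dK _; apply: le_trans C1.2.2.1 _.
    by rewrite -[leLHS]mulr1 ler_wpM2l//; lra.
  (* For [mu < 1], squaring [K * d ^ 2 <= 2 * lam] and using [4 * d <= d ^ 4] gives
     [d <= lam ^ 2 / K ^ 2], and [lam ^ 2 = mu ^ 4 <= mu ^ 3]. *)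
  have mu34 : lam ^+ 2 <= mu ^+ 3.
    by rewrite lamE -exprM ler_wiXn2l// ltW.
  apply: le_trans (_ : (K ^+ 2)^-1 * lam ^+ 2 <= _); last first.
    by rewrite ler_pM ?sqr_ge0 ?invr_ge0 ?sqr_ge0//; case: C1 => _ [_ []].
  rewrite mulrC ler_pdivlMr ?exprn_gt0//.
  have : (K * d%:R ^+ 2) ^+ 2 <= (2%:R * lam) ^+ 2.
    have h0 : 0 <= K * d%:R ^+ 2 by rewrite mulr_ge0 ?sqr_ge0// ltW.
    by rewrite ler_pXn2r// nnegrE; lra.
  rewrite !exprMn => H.
  have q1 : 2%:R * d%:R <= d%:R ^+ 2 :> R by nra.
  have d4 : 4%:R * d%:R <= (d%:R ^+ 2) ^+ 2 :> R by rewrite [leRHS]expr2; nra.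
  have := ler_wpM2l (sqr_ge0 K) d4. lra.
pose k := d%:R / lam.
have k0 : 0 < k by rewrite divr_gt0.
have lamk : lam * k = d%:R by rewrite /k mulrC divfK// gt_eqF.
have mix := expander_mixing eS eR V0 eL (ltW lam0) lamd.
have half := lam_ge_half eR V0 mix d0 n2.
have := deficit_le eS V0 mu0 lamE k0 lamk mix g h.
have nd0 : 0 < n - d%:R by rewrite subr_gt0.
rewrite (accept_gap R eR d0 dn) ler_pdivrMr ?mulr_gt0//.
rewrite [X in _ -> _ <= X](_ : _ = Cc * mu ^+ 3 * (n - d%:R)); last first.
  by rewrite mulrA divfK// gt_eqF.
move=> /le_trans; apply.
have mud : 1 <= mu * d%:R by rewrite lamE in half; nra.
(* This absorbs the light term [2 * d ^ 2] into a multiple of [mu ^ 3 * n]: one factor [d] of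
   [K * d ^ 3] is traded against [mu * d >= 1]. *)
have munK : K * d%:R ^+ 2 <= mu ^+ 3 * n.
  apply: le_trans (_ : mu * (K * d%:R ^+ 3) <= _).
    rewrite (_ : mu * _ = (mu * d%:R) * (K * d%:R ^+ 2)); last by ring.
    by rewrite ler_peMl// mulr_ge0 ?sqr_ge0// ltW.
  rewrite [leRHS](_ : _ = mu * (lam * n)); last by rewrite lamE; ring.
  by rewrite ler_pM2l.
have m3n : 0 <= mu ^+ 3 * n by rewrite mulr_ge0 ?exprn_ge0 ?ltW//; lra.
(* Since [n >= 2 * d], [n - d] is at least [n / 2], which doubles the constants [3] and [2 / K]. *)
apply: le_trans (_ : (6%:R + 4%:R / K) * mu ^+ 3 * (n / 2%:R) <= _); last first.
  apply: ler_pM => //.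
  - by rewrite mulr_ge0 ?exprn_ge0 ?(ltW mu0)// ltW// addr_gt0// divr_gt0.
  - lra.
  - by rewrite ler_wpM2r ?exprn_ge0 ?(ltW mu0)//; case: C1 => _ [].
  - rewrite -/n; lra.
rewrite [leRHS](_ : _ = 3%:R * mu ^+ 3 * n + 2%:R * (mu ^+ 3 * n / K)); last first.
  by field; rewrite gt_eqF.
by rewrite lerD2l ler_pM2l// ler_pdivlMr// mulrC.
Qed.
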